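(* Let $\emptyset\neq\mathcal{Y}\subseteq\mathbb{R}^n$ and $u\in\mathcal{Y}$. Let $\mathbf{\Phi}_1,\mathbf{\Phi}_2:\mathcal{Y}\to I(\mathbb{R})$ be $gH$-weak subdifferentiable at $u$, and suppose $u$ is a weak efficient point of $\mathbf{\Phi}_2\ominus_{gH}\mathbf{\Phi}_1$. If $\mathbf{\Phi}_1(u)=\mathbf{\Phi}_2(u)$, then $$\partial^w\mathbf{\Phi}_1(u)\subset\partial^w\mathbf{\Phi}_2(u).$$
   Context: $I(\mathbb{R})$ is the set of compact intervals $\mathbf{X}=[\underline{x},\overline{x}]$, $\underline{x}\le\overline{x}$; a real number $c$ is identified with $[c,c]$. Operations: $\mathbf{X}\oplus\mathbf{Y}=[\underline{x}+\underline{y},\overline{x}+\overline{y}]$; $\lambda\odot\mathbf{X}=[\min\{\lambda\underline{x},\lambda\overline{x}\},\max\{\lambda\underline{x},\lambda\overline{x}\}]$ for $\lambda\in\mathbb{R}$; $gH$-difference $\mathbf{X}\ominus_{gH}\mathbf{Y}=[\min\{\underline{x}-\underline{y},\overline{x}-\overline{y}\},\max\{\underline{x}-\underline{y},\overline{x}-\overline{y}\}]$. Order: $\mathbf{X}\preceq\mathbf{Y}$ iff $\underline{x}\le\underline{y}$ and $\overline{x}\le\overline{y}$. For $\widehat{\mathbf{G}}=(\mathbf{G}_1,\dots,\mathbf{G}_n)\in I(\mathbb{R})^n$ and $d\in\mathbb{R}^n$, $\widehat{\mathbf{G}}^\top\odot d=\bigoplus_{i=1}^n d_i\odot\mathbf{G}_i$.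 $\mathbb{R}_+=[0,\infty)$ and $\|\cdot\|$ is the Euclidean norm. $(\mathbf{\Phi}_2\ominus_{gH}\mathbf{\Phi}_1)(y)=\mathbf{\Phi}_2(y)\ominus_{gH}\mathbf{\Phi}_1(y)$. The $gH$-weak subdifferential of $\mathbf{\Phi}:\mathcal{Y}\to I(\mathbb{R})$ at $u\in\mathcal{Y}$ is $$\partial^w\mathbf{\Phi}(u)=\{(\widehat{\mathbf{G}},c)\in I(\mathbb{R})^n\times\mathbb{R}_+:\ \widehat{\mathbf{G}}^\top\odot(y-u)\ominus_{gH}c\|y-u\|\preceq\mathbf{\Phi}(y)\ominus_{gH}\mathbf{\Phi}(u)\ \ \forall y\in\mathcal{Y}\};$$ $\mathbf{\Phi}$ is $gH$-weak subdifferentiable at $u$ if this set is nonempty. A point $u\in\mathcal{Y}$ is a weak efficient point of $\mathbf{\Phi}$ if $\mathbf{\Phi}(u)\preceq\mathbf{\Phi}(y)$ for all $y\in\mathcal{Y}$. The symbol $\subset$ denotes (not necessarily strict) inclusion. *)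

(* Defs.v *)
From mathcomp Require Import all_boot all_order all_algebra.
From mathcomp Require Import classical_sets reals.

Set Implicit Arguments.
Unset Strict Implicit.
Unset Printing Implicit Defensive.

Import Order.TTheory GRing.Theory Num.Theory.
Local Open Scope ring_scope.
Local Open Scope classical_set_scope.

(* Nonempty compact intervals [lo X, hi X]. The bound condition is boolean,
   hence proof-irrelevant: equality is equality of both endpoints
   (lemma [cint_eq]). *)
Record cint (R : realType) := Cint {
  lo : R;
  hi : R;
  lo_le_hi : lo <= hi
}.

Lemma cint_eq (R : realType) (X Y : cint R) :
  lo X = lo Y -> hi X = hi Y -> X = Y.
Proof.
case: X Y => [a b ab] [a' b' ab'] /= ea eb.
by subst a' b'; congr Cint; apply: bool_irrelevance.
Qed.

Lemma le_min_max (R : realType) (a b : R) : Num.min a b <= Num.max a b.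
Proof. by rewrite ge_min !le_max lexx. Qed.

Definition cint_const (R : realType) (c : R) : cint R := Cint (lexx c).

Definition cint_add (R : realType) (X Y : cint R) : cint R :=
  Cint (lerD (lo_le_hi X) (lo_le_hi Y)).

Definition cint_scale (R : realType) (a : R) (X : cint R) : cint R :=
  Cint (le_min_max (a * lo X) (a * hi X)).

Definition gH_sub (R : realType) (X Y : cint R) : cint R :=
  Cint (le_min_max (lo X - lo Y) (hi X - hi Y)).

Definition cint_le (R : realType) (X Y : cint R) : Prop :=
  lo X <= lo Y /\ hi X <= hi Y.

Definition cint_dot (R : realType) (n : nat) (G : 'rV[cint R]_n)
    (d : 'rV[R]_n) : cint R :=
  \big[@cint_add R/cint_const 0]_(i < n) cint_scale (d 0 i) (G 0 i).

(* The norm [`|x|] that the library puts on ['rV[R]_n] is the maximum norm. *)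
Definition enorm (R : realType) (n : nat) (x : 'rV[R]_n) : R :=
  Num.sqrt (\sum_(i < n) x 0 i ^+ 2).

(* A map defined only on a subset Y of R^n is a function on the subtype of
   elements of Y, whose inclusion into R^n is [val]. *)
Definition gH_sub_fun (R : realType) (n : nat) (Y : set 'rV[R]_n)
    (Phi2 Phi1 : Y -> cint R) : Y -> cint R :=
  fun y => gH_sub (Phi2 y) (Phi1 y).

Definition weak_subdiff (R : realType) (n : nat) (Y : set 'rV[R]_n)
    (Phi : Y -> cint R) (u : Y) : set ('rV[cint R]_n * R) :=
  [set Gc | 0 <= Gc.2 /\
    forall y : Y,
      cint_le
        (gH_sub (cint_dot Gc.1 (val y - val u))
                (cint_const (Gc.2 * enorm (val y - val u))))
        (gH_sub (Phi y) (Phi u))].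

Definition weak_subdifferentiable (R : realType) (n : nat)
    (Y : set 'rV[R]_n) (Phi : Y -> cint R) (u : Y) : Prop :=
  weak_subdiff Phi u !=set0.

Definition weak_efficient (R : realType) (n : nat) (Y : set 'rV[R]_n)
    (Phi : Y -> cint R) (u : Y) : Prop :=
  forall y : Y, cint_le (Phi u) (Phi y).

(* Main.v *)
(** Since [Phi1 u = Phi2 u], weak efficiency of [u] says that
    [Phi2 y - Phi1 y >= 0], i.e. [Phi1 y <= Phi2 y], for every [y]. The
    gH-difference is monotone in its first argument, so the right-hand side of
    the subgradient inequality only grows when [Phi1] is replaced by [Phi2]. *)
Require Import Defs.
From mathcomp Require Import all_boot all_order all_algebra.
From mathcomp Require Import classical_sets reals.

Import Order.TTheory GRing.Theory Num.Theory.

Local Open Scope ring_scope.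
Local Open Scope classical_set_scope.

Lemma cint_le_trans (R : realType) (X Y Z : cint R) :
  cint_le X Y -> cint_le Y Z -> cint_le X Z.
Proof.
by move=> [lXY hXY] [lYZ hYZ]; split;
  [exact: le_trans lXY lYZ | exact: le_trans hXY hYZ].
Qed.

Lemma gH_subXX (R : realType) (X : cint R) : gH_sub X X = cint_const 0.
Proof. by apply: cint_eq; rewrite /= !subrr ?minxx ?maxxx. Qed.

(** The lower endpoint of a gH-difference is the minimum of both endpoint differences, so its sign
    alone settles both inequalities. *)
Lemma gH_sub_ge0 (R : realType) (X Y : cint R) :
  cint_le (cint_const 0) (gH_sub Y X) -> cint_le X Y.
Proof.
by case=> /= + _; rewrite le_min !subr_ge0 => /andP[lXY hXY]; split.
Qed.

(** [min] and [max] are monotone in each argument. *)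
Lemma gH_sub_le2r (R : realType) (X Y Z : cint R) :
  cint_le X Y -> cint_le (gH_sub X Z) (gH_sub Y Z).
Proof.
move=> [lXY hXY]; split => /=.
- by rewrite le_min !ge_min !lerD2r lXY hXY orbT.
- by rewrite ge_max !le_max !lerD2r lXY hXY orbT.
Qed.

Theorem theorem11 (R : realType) (n : nat) (Y : set 'rV[R]_n)
    (hY : Y !=set0) (u : Y) (Phi1 Phi2 : Y -> cint R)
    (hPhi1 : weak_subdifferentiable Phi1 u)
    (hPhi2 : weak_subdifferentiable Phi2 u)
    (hu : weak_efficient (gH_sub_fun Phi2 Phi1) u)
    (huu : Phi1 u = Phi2 u) :
  weak_subdiff Phi1 u `<=` weak_subdiff Phi2 u.
Proof.
move=> Gc [c_ge0 Gc_sub]; split=> // y.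
(* By [huu], both gH-differences subtract the same interval [Phi2 u]. *)
apply: cint_le_trans (Gc_sub y) _; rewrite huu.
apply/gH_sub_le2r/gH_sub_ge0.
(* The value at [u] of the difference of the two maps is zero by [huu]. *)
by have := hu y; rewrite /gH_sub_fun huu gH_subXX.
Qed.
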